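(* Let $T_\lambda $ be a conformal averaging operator on $\mathfrak {sl}_2=\mathfrak{sl}_2(\mathbb C)$. Then, up to an automorphism of $\mathfrak {sl}_2$ (that is, after replacing $T_\lambda$ by $\sigma T_\lambda\sigma^{-1}$ for some automorphism $\sigma$ of $\mathfrak{sl}_2$), $T_\lambda $ is one of the following: (1) $T_\lambda =\alpha\, \mathrm{id}$, $\alpha \in \mathbb C$; (2) $T_\lambda(e)=T_\lambda (f)=0$, $T_\lambda (h)=\varphi(\lambda )h$; (3) $T_\lambda(e)=T_\lambda (h)=0$, $T_\lambda (f)=\varphi(\lambda )e$, where $\varphi(\lambda )\in \mathbb C[\lambda ]$ is an arbitrary nonzero polynomial.
   Context: $f,e,h$ is the standard basis of $\mathfrak{sl}_2$ over $\mathbb C$: $[h,e]=2e$, $[h,f]=-2f$, $[e,f]=h$. A conformal averaging operator on a Lie algebra $\mathfrak g$ is a linear map $T_\lambda:\mathfrak g\to\mathfrak g[\lambda]$ ($\lambda,\mu$ formal variables) such that $$T_{\lambda+\mu}([T_\lambda (x),y]) = [T_\lambda (x), T_\mu(y)] \in \mathfrak g[\lambda, \mu ]\quad\text{for all }x,y\in\mathfrak g,$$ where maps and brackets are extended linearly in the polynomial variables (automorphisms $\sigma$ of $\mathfrak g$ are likewise extended to $\mathfrak g[\lambda]$ coefficientwise). *)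

(* Defs.v *)
From HB Require Import structures.
From mathcomp Require Import all_boot all_order all_algebra.
From mathcomp Require Import reals complex.

Set Implicit Arguments.
Unset Strict Implicit.
Unset Printing Implicit Defensive.

Import GRing.Theory.
Local Open Scope ring_scope.

Section SpecialLinear.

Variables (n : nat) (K : comNzRingType).

Definition traceless : {pred 'M[K]_n} := fun A => \tr A == 0.

Fact traceless_submod_closed : submod_closed traceless.
Proof.
split=> [|a A B]; rewrite !unfold_in /= ?mxtrace0 // => /eqP trA /eqP trB.
by rewrite linearP /= trA trB mulr0 addr0.
Qed.
HB.instance Definition _ :=
  GRing.isSubmodClosed.Build K 'M[K]_n traceless traceless_submod_closed.

Record sl := Sl { slval :> 'M[K]_n; _ : slval \in traceless }.

HB.instance Definition _ := [isSub for slval].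
HB.instance Definition _ := [Choice of sl by <:].
HB.instance Definition _ := [SubChoice_isSubLmodule of sl by <:].

Fact lie_subproof (A B : sl) : A *m B - B *m A \in traceless.
Proof. by rewrite unfold_in /= linearB /= mxtrace_mulC subrr. Qed.
Definition lie (A B : sl) : sl := Sl (lie_subproof A B).

Definition lie_automorphism (s : sl -> sl) : Prop :=
  [/\ linear s, {morph s : x y / lie x y} & bijective s].

End SpecialLinear.

(* Entrywise application of an additive map.  With polynomial entries, sl n *)
(* of {poly K} is the Lie algebra g[lambda] for g = sl n K, and sl n of     *)
(* {poly {poly K}} is g[lambda, mu], the inner variable 'X%:P being lambda  *)
(* and the outer variable 'X being mu.                                      *)
Section EntrywiseMap.

Variables (n : nat) (K L : comNzRingType) (f : {additive K -> L}).

Fact slmap_subproof (A : sl n K) : map_mx f A \in @traceless n L.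
Proof.
case: A => A /= trA; rewrite unfold_in /=; apply/eqP.
rewrite unfold_in /= in trA.
transitivity (f (\tr A)); last by rewrite (eqP trA) raddf0.
by rewrite /mxtrace raddf_sum; apply: eq_bigr => i _; rewrite mxE.
Qed.
Definition slmap (A : sl n K) : sl n L := Sl (slmap_subproof A).

End EntrywiseMap.

Fact poly_XaY_is_zmod_morphism (K : comNzRingType) :
  zmod_morphism (@poly_XaY K).
Proof. by move=> p q; rewrite /poly_XaY !raddfB. Qed.
HB.instance Definition _ (K : comNzRingType) :=
  GRing.isZmodMorphism.Build {poly K} {poly {poly K}} (@poly_XaY K)
    (@poly_XaY_is_zmod_morphism K).

Section Conformal.

Variables (n : nat) (K : comNzRingType).
Local Notation g := (sl n K).
Local Notation "g[lambda]" := (sl n {poly K}).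
Local Notation "g[lambda,mu]" := (sl n {poly {poly K}}).

Definition slconst : g -> g[lambda] := slmap polyC.
Definition slcoef (k : nat) : g[lambda] -> g := slmap (coefp k).
Definition slsize (z : g[lambda]) : nat := \max_i \max_j size (z i j).

(* The extension of F to g[lambda] with lambda acting on the target as a : *)
(* sum_k lambda^k z_k is sent to sum_k a^k F(z_k).                         *)
Definition slext (L : comNzRingType) (a : L) (F : g -> sl n L)
    (z : g[lambda]) : sl n L :=
  \sum_(k < slsize z) a ^+ k *: F (slcoef k z).

(* K-linear maps: T (a *: x + y) = a%:P *: T x + T y. *)
Definition sl_conformal_map := {linear g -> g[lambda] | polyC \; *:%R}.

Definition at_lambda (z : g[lambda]) : g[lambda,mu] := slmap polyC z.
Definition at_mu (z : g[lambda]) : g[lambda,mu] := slmap (map_poly polyC) z.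
Definition at_lambda_plus_mu (z : g[lambda]) : g[lambda,mu] :=
  slmap (@poly_XaY K) z.

Definition conformal_averaging (T : g -> g[lambda]) : Prop :=
  forall x y : g,
    slext 'X%:P (at_lambda_plus_mu \o T) (lie (T x) (slconst y))
    = lie (at_lambda (T x)) (at_mu (T y)).

Definition slconj (s s' : g -> g) (T : g -> g[lambda]) : g -> g[lambda] :=
  fun x => slext 'X (slconst \o s) (T (s' x)).

End Conformal.

Section StandardBasis.

Variable K : comNzRingType.

Fact sl2_e_subproof : delta_mx 0 1 \in @traceless 2 K.
Proof. by rewrite unfold_in /= /mxtrace !big_ord_recl big_ord0 !mxE /= !addr0. Qed.
Fact sl2_f_subproof : delta_mx 1 0 \in @traceless 2 K.
Proof. by rewrite unfold_in /= /mxtrace !big_ord_recl big_ord0 !mxE /= !addr0. Qed.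
Fact sl2_h_subproof : delta_mx 0 0 - delta_mx 1 1 \in @traceless 2 K.
Proof.
rewrite unfold_in /= /mxtrace !big_ord_recl big_ord0 !mxE /=.
by rewrite subr0 addr0 sub0r subrr.
Qed.

Definition sl2_e : sl 2 K := Sl sl2_e_subproof.
Definition sl2_f : sl 2 K := Sl sl2_f_subproof.
Definition sl2_h : sl 2 K := Sl sl2_h_subproof.

Lemma lie_he : lie sl2_h sl2_e = 2%:R *: sl2_e.
Proof.
apply/val_inj; rewrite linearZ /= mulmxBl mulmxBr !mul_delta_mx_cond /=.
by rewrite !(mulr1n, mulr0n) subr0 sub0r opprK scaler_nat.
Qed.

Lemma lie_hf : lie sl2_h sl2_f = - 2%:R *: sl2_f.
Proof.
apply/val_inj; rewrite linearZ /= mulmxBl mulmxBr !mul_delta_mx_cond /=.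
by rewrite !(mulr1n, mulr0n) subr0 sub0r scaleNr scaler_nat mulr2n opprD.
Qed.

Lemma lie_ef : lie sl2_e sl2_f = sl2_h.
Proof. by apply/val_inj; rewrite /= !mul_delta_mx. Qed.

End StandardBasis.

Arguments sl2_e {K}.
Arguments sl2_f {K}.
Arguments sl2_h {K}.

(* Main.v *)
(* Evaluating lambda at scalars turns T into linear maps T_a, polynomial in a,
   with T_(a+b) [T_a x, y] = [T_a x, T_b y]; polynomial identities valid where
   some nonzero polynomial does not vanish hold everywhere.
   If det T_c != 0 for some c, antisymmetry of the right-hand side and
   injectivity of T_c for generic c give [T_a x, y] = [x, T_0 y], hence T is a
   constant scalar.  Otherwise:
   - Rank 2 is impossible: the normals n(a) = [T_a x, T_a y] to the images are
     mutually orthogonal and isotropic, hence proportional to one n0; then all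
     images lie in the orthogonal of n0, brackets of such elements commute with
     n0, and so T_c maps everything into the line of n0.
   - In rank 1, [T_a x, T_b y] = 0, since otherwise T_a x and T_b y would be
     isotropic and orthogonal.  So all images lie on one line spanned by v, and
     T_a kills [v, g]; conjugating v to e or to a multiple of h gives the
     normal forms. *)
From HB Require Import structures.
Require Import Defs.
From mathcomp Require Import all_boot all_order all_algebra.
From mathcomp Require Import boolp reals complex ring.

Import GRing.Theory Num.Theory.
Local Open Scope ring_scope.
Local Open Scope complex_scope.

(** * Matrix coordinates on sl_2 and the trace form *)

Section Sl2.

Set Implicit Arguments.
Unset Strict Implicit.

Variable K : comNzRingType.
Implicit Types x y z : sl 2 K.

Lemma sl2_trace x : x 1 1 = - x 0 0.
Proof.
case: x => x /=; rewrite unfold_in /= /mxtrace !big_ord_recl big_ord0 addr0 /=.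
rewrite (_ : lift ord0 ord0 = 1); last exact: val_inj.
by rewrite addrC addr_eq0 => /eqP.
Qed.

Lemma ord2 (i : 'I_2) : i = 0 \/ i = 1.
Proof. by case: i => [[|[|//]] p]; [left | right]; apply/val_inj. Qed.

Lemma mulmx22E (A B : 'M[K]_2) i j :
  (A *m B) i j = A i 0 * B 0 j + A i 1 * B 1 j.
Proof.
rewrite !mxE !big_ord_recl big_ord0 addr0.
by rewrite (_ : lift ord0 ord0 = 1) //; exact: val_inj.
Qed.

Lemma sl2P x y : x 0 1 = y 0 1 -> x 1 0 = y 1 0 -> x 0 0 = y 0 0 -> x = y.
Proof.
move=> e01 e10 e00; apply/val_inj/matrixP => i j.
have [-> | ->] := ord2 i; have [-> | ->] := ord2 j => //=.
by rewrite !sl2_trace e00.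
Qed.

Lemma lie00 x y : lie x y 0 0 = x 0 1 * y 1 0 - x 1 0 * y 0 1.
Proof.
by rewrite /= [LHS]mxE [X in _ + X]mxE !mulmx22E ?sl2_trace; ring.
Qed.

Lemma lie01 x y : lie x y 0 1 = 2%:R * (x 0 0 * y 0 1 - x 0 1 * y 0 0).
Proof.
by rewrite /= [LHS]mxE [X in _ + X]mxE !mulmx22E ?sl2_trace; ring.
Qed.

Lemma lie10 x y : lie x y 1 0 = 2%:R * (x 1 0 * y 0 0 - x 0 0 * y 1 0).
Proof.
by rewrite /= [LHS]mxE [X in _ + X]mxE !mulmx22E ?sl2_trace; ring.
Qed.

(** One quarter of the Killing form. With it sl_2 behaves like three-space: [lie] is a cross product
    and [trform] the scalar product, up to constants. *)
Definition trform x y : K := \tr (x *m y).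

Lemma trformE x y :
  trform x y = 2%:R * x 0 0 * y 0 0 + x 0 1 * y 1 0 + x 1 0 * y 0 1.
Proof.
rewrite /trform /mxtrace !big_ord_recl big_ord0 !mulmx22E.
rewrite (_ : lift ord0 ord0 = 1); last exact: val_inj.
by rewrite !sl2_trace /=; ring.
Qed.

Lemma sl2DE x y i j : (x + y) i j = x i j + y i j.
Proof. by rewrite /= mxE. Qed.

Lemma sl2NE x i j : (- x) i j = - x i j.
Proof. by rewrite /= mxE. Qed.

Lemma sl2ZE a x i j : (a *: x) i j = a * x i j.
Proof. by rewrite /= mxE. Qed.

Lemma sl2_0E i j : (0 : sl 2 K) i j = 0.
Proof. by rewrite /= mxE. Qed.

Definition sl2E := (lie00, lie01, lie10, sl2DE, sl2NE, sl2ZE, sl2_0E).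

End Sl2.

Ltac sl2_ring :=
  rewrite ?trformE; first [apply: sl2P | idtac]; rewrite ?sl2E; ring.

(** * Vector identities for the bracket and the trace form *)

Section Identities.

Set Implicit Arguments.
Unset Strict Implicit.

Variable K : comNzRingType.
Implicit Types x y z w : sl 2 K.

Lemma lieC x y : lie x y = - lie y x.
Proof. by sl2_ring. Qed.

Lemma liexx x : lie x x = 0.
Proof. by sl2_ring. Qed.

Lemma lie0x x : lie 0 x = 0.
Proof. by sl2_ring. Qed.

Lemma liex0 x : lie x 0 = 0.
Proof. by sl2_ring. Qed.

Lemma lieDl x y z : lie (x + y) z = lie x z + lie y z.
Proof. by sl2_ring. Qed.

Lemma lieDr x y z : lie z (x + y) = lie z x + lie z y.
Proof. by sl2_ring. Qed.

Lemma lieZl a x y : lie (a *: x) y = a *: lie x y.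
Proof. by sl2_ring. Qed.

Lemma lieZr a x y : lie x (a *: y) = a *: lie x y.
Proof. by sl2_ring. Qed.

Lemma trformC x y : trform x y = trform y x.
Proof. by sl2_ring. Qed.

Lemma trform0x x : trform 0 x = 0.
Proof. by sl2_ring. Qed.

Lemma trformx0 x : trform x 0 = 0.
Proof. by sl2_ring. Qed.

Lemma trformZl a x y : trform (a *: x) y = a * trform x y.
Proof. by sl2_ring. Qed.

Lemma trform_lie x y z : trform x (lie y z) = trform (lie x y) z.
Proof. by sl2_ring. Qed.

(** The analogue of the double cross product formula. *)
Lemma lie_lie x y z :
  lie x (lie y z) = 2%:R *: (trform x y *: z - trform x z *: y).
Proof. by sl2_ring. Qed.

(** Cramer's rule: up to the triple product, the three brackets form the basis dual to [x], [y],
    [z]. *)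
Lemma trform_dual x y z w :
  trform (lie x y) z *: w =
  trform w x *: lie y z + trform w y *: lie z x + trform w z *: lie x y.
Proof. by sl2_ring. Qed.

Lemma sl2_decomp x : x = x 0 1 *: sl2_e + x 1 0 *: sl2_f + x 0 0 *: sl2_h.
Proof. by apply: sl2P; rewrite !sl2E /= !mxE /=; ring. Qed.

End Identities.

(** * Commuting and isotropic vectors over an algebraically closed field *)

Section Field.

Set Implicit Arguments.
Unset Strict Implicit.

Variable F : numClosedFieldType.
Implicit Types (x y z v w : sl 2 F) (a b c : F).

Lemma trform_nondegenerate x : x != 0 -> exists z, trform x z != 0.
Proof.
move=> x0; have [/eqP h|] := boolP (trform x sl2_f == 0); last by exists sl2_f.
have [/eqP e|] := boolP (trform x sl2_e == 0); last by exists sl2_e.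
exists sl2_h; apply: contraNneq x0 => hh; apply/eqP.
move: h e hh; rewrite !trformE /= !mxE /= !(mulr0, mulr1, addr0, add0r, subr0).
move=> h e /eqP; rewrite oppr0 !mulr0 !addr0 mulf_eq0 pnatr_eq0 /= => /eqP hh.
by apply: sl2P; rewrite sl2E.
Qed.

(** Bracketing [lie v x = 0] with some [z] not orthogonal to [v] and expanding the double bracket
    expresses [x] through [v]. *)
Lemma lie_eq0 v x : v != 0 -> lie v x = 0 -> exists t, x = t *: v.
Proof.
move=> /trform_nondegenerate[z vz] vx0; exists (trform z x / trform v z).
have := lie_lie z v x; rewrite vx0 liex0 => /esym/eqP.
rewrite scaler_eq0 pnatr_eq0 /= subr_eq0 => /eqP e.
by rewrite mulrC -scalerA -e scalerA (trformC z) mulVf ?scale1r.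
Qed.

Lemma lie_eq0_trans v x y : v != 0 -> lie v x = 0 -> lie v y = 0 -> lie x y = 0.
Proof.
move=> v0 /(lie_eq0 v0)[s ->] /(lie_eq0 v0)[t ->].
by rewrite lieZl lieZr liexx !scaler0.
Qed.

(** The double bracket of [x], [x], [y] vanishes, so [lie x y = t *: x]; that of [y], [x], [y]
    vanishes too, which forces [t ^+ 2 *: x = 0]. *)
Lemma lie_isotropic x y :
  trform x x = 0 -> trform y y = 0 -> trform x y = 0 -> lie x y = 0.
Proof.
move=> xx yy xy; have [->|x0] := eqVneq x 0; first exact: lie0x.
have := lie_lie x x y; rewrite xx xy !scale0r subrr scaler0.
move=> /(lie_eq0 x0)[t e]; have := lie_lie y x y.
rewrite yy trformC xy !scale0r subrr scaler0 e lieZr lieC e => /eqP.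
rewrite scalerN oppr_eq0 !scaler_eq0 (negPf x0) orbF orbb => /eqP->.
by rewrite scale0r.
Qed.

Lemma lie_span x y z :
  lie x y != 0 -> exists y1 y2, z = lie x y1 + lie y y2.
Proof.
(* Both witnesses are read off [trform_dual x y m z]: each of its three brackets involves [x] or
   [y]. *)
move=> /trform_nondegenerate[m dm]; set d := trform _ _ in dm.
exists (d^-1 *: (trform z m *: y - trform z y *: m)), ((trform z x / d) *: m).
apply: (scalerI dm); rewrite trform_dual -/d.
rewrite scalerDr -!lieZr !scalerA mulfV // scale1r mulrCA mulfV // mulr1.
rewrite lieDr -scaleNr !lieZr (lieC m x); move: (lie _ _) (lie _ _) (lie _ _).
by move=> A B C; apply: sl2P; rewrite !sl2E; ring.
Qed.

(** * Polynomial functions and density arguments *)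

Definition polyfun (f : F -> F) := exists p : {poly F}, forall a, f a = p.[a].
Definition polyvec (u : F -> sl 2 F) :=
  forall i j, polyfun (fun a => u a i j).

Lemma polyfun_cst c : polyfun (fun=> c).
Proof. by exists c%:P => a; rewrite hornerC. Qed.

Lemma eq_polyfun f g : f =1 g -> polyfun g -> polyfun f.
Proof. by move=> fg [p pg]; exists p => a; rewrite fg pg. Qed.

Lemma polyfunD f g : polyfun f -> polyfun g -> polyfun (fun a => f a + g a).
Proof. by move=> [p pf] [q qg]; exists (p + q) => a; rewrite hornerD pf qg. Qed.

Lemma polyfunN f : polyfun f -> polyfun (fun a => - f a).
Proof. by move=> [p pf]; exists (- p) => a; rewrite hornerN pf. Qed.

Lemma polyfunM f g : polyfun f -> polyfun g -> polyfun (fun a => f a * g a).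
Proof. by move=> [p pf] [q qg]; exists (p * q) => a; rewrite hornerM pf qg. Qed.

Ltac polyfun_tac :=
  do ?[apply: polyfunD | apply: polyfunN | apply: polyfunM
      | exact: polyfun_cst].

Lemma poly_eq0_horner (p : {poly F}) : (forall a, p.[a] = 0) -> p = 0.
Proof.
move=> p0; apply: contraTeq isT => /closed_nonrootP[a].
by rewrite /root p0 eqxx.
Qed.

Lemma poly_eq_horner (p q : {poly F}) : (forall a, p.[a] = q.[a]) -> p = q.
Proof.
move=> pq; apply/subr0_eq/poly_eq0_horner => a.
by rewrite hornerD hornerN pq subrr.
Qed.

(** The product of the two polynomials has only zero values, hence is zero, and [{poly F}] is an
    integral domain. *)
Lemma polyfun_dense f g a0 : polyfun f -> polyfun g -> g a0 != 0 ->
  (forall a, g a != 0 -> f a = 0) -> forall a, f a = 0.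
Proof.
move=> [p pf] [q qg] g0 fg.
have /eqP : p * q = 0.
  apply: poly_eq0_horner => a; rewrite hornerM -pf -qg.
  by have [->|/fg->] := eqVneq (g a) 0; rewrite ?mulr0 ?mul0r.
rewrite mulf_eq0 => /orP[/eqP p0 a|/eqP q0].
  by rewrite pf p0 horner0.
by move: g0; rewrite qg q0 horner0 eqxx.
Qed.

Lemma sl2_neq0 x : x != 0 -> exists i j, x i j != 0.
Proof.
move=> x0; have [/eqP e|] := boolP (x 0 1 == 0); last by exists 0, 1.
have [/eqP f|] := boolP (x 1 0 == 0); last by exists 1, 0.
exists 0, 0; apply: contraNneq x0 => h; apply/eqP.
by apply: sl2P; rewrite sl2E.
Qed.

Lemma polyvec_dense f u a0 : polyfun f -> polyvec u -> u a0 != 0 ->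
  (forall a, u a != 0 -> f a = 0) -> forall a, f a = 0.
Proof.
move=> fP uP /sl2_neq0[i [j ua0]] fu.
apply: polyfun_dense (uP i j) ua0 _ => // a ua; apply: fu.
by apply: contraNneq ua => ->; rewrite sl2E.
Qed.

Lemma polyfun_trform (u v : F -> sl 2 F) : polyvec u -> polyvec v ->
  polyfun (fun a => trform (u a) (v a)).
Proof.
move=> uP vP; apply: eq_polyfun (fun a => trformE _ _) _.
by polyfun_tac.
Qed.

Lemma polyvec_cst x : polyvec (fun=> x).
Proof. by move=> i j; exact: polyfun_cst. Qed.

Lemma polyvec_lie (u v : F -> sl 2 F) : polyvec u -> polyvec v ->
  polyvec (fun a => lie (u a) (v a)).
Proof.
move=> uP vP i j.
have B : polyfun (fun a => u a 0 1 * v a 1 0 - u a 1 0 * v a 0 1).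
  by polyfun_tac.
have [-> | ->] := ord2 i; have [-> | ->] := ord2 j.
- exact: eq_polyfun (fun a => lie00 _ _) B.
- apply: eq_polyfun (fun a => lie01 _ _) _.
  by polyfun_tac.
- apply: eq_polyfun (fun a => lie10 _ _) _.
  by polyfun_tac.
- apply: eq_polyfun (fun a => sl2_trace _) _; apply: polyfunN.
  exact: eq_polyfun (fun a => lie00 _ _) B.
Qed.

Lemma polyvec_shift u b : polyvec u -> polyvec (fun a => u (a + b)).
Proof.
move=> uP i j; have [p pE] := uP i j.
by exists (p \Po ('X + b%:P)) => a; rewrite horner_comp !hornerE -pE.
Qed.

(** The triple product is alternating and trilinear, so it gets multiplied by the determinant of the
    coefficients. *)
Lemma trform_lie_comb (p q r : sl 2 F) a1 a2 a3 b1 b2 b3 c1 c2 c3 :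
  trform (lie (a1 *: p + a2 *: q + a3 *: r) (b1 *: p + b2 *: q + b3 *: r))
    (c1 *: p + c2 *: q + c3 *: r) =
  (a1 * (b2 * c3 - b3 * c2) - a2 * (b1 * c3 - b3 * c1) +
   a3 * (b1 * c2 - b2 * c1)) * trform (lie p q) r.
Proof. by sl2_ring. Qed.

Lemma trform_lie_free (p q r : sl 2 F) a b c :
  trform (lie p q) r != 0 -> a *: p + b *: q + c *: r = 0 ->
  [/\ a = 0, b = 0 & c = 0].
Proof.
move=> d0 e.
(* Pairing the relation with the bracket of two of the vectors isolates the coefficient of the
   third. *)
have H u k :
    trform u (a *: p + b *: q + c *: r) = k * trform (lie p q) r -> k = 0.
  by rewrite e trformx0 => /esym/eqP; rewrite mulf_eq0 (negPf d0) orbF => /eqP.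
by split; [apply: (H (lie q r)) | apply: (H (lie r p))
  | apply: (H (lie p q))]; sl2_ring.
Qed.

Lemma sl2_e_neq0 : sl2_e != 0 :> sl 2 F.
Proof.
apply/eqP => /(congr1 (fun x : sl 2 F => x 0 1)); rewrite sl2E /= mxE => /eqP.
by rewrite oner_eq0.
Qed.

Lemma sl2_h_neq0 : sl2_h != 0 :> sl 2 F.
Proof.
apply/eqP => /(congr1 (fun x : sl 2 F => x 0 0)); rewrite sl2E /= !mxE /= subr0.
by move/eqP; rewrite oner_eq0.
Qed.

Lemma lie_center (x : sl 2 F) : (forall y, lie x y = 0) -> x = 0.
Proof.
move=> xy; apply/eqP; apply: contraT => x0.
by have := lie_eq0_trans x0 (xy sl2_e) (xy sl2_f); rewrite lie_ef => /eqP;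
  rewrite (negPf sl2_h_neq0).
Qed.

End Field.

(** * Polynomial families of linear maps with the averaging identity at scalars *)

Section Family.

Set Implicit Arguments.
Unset Strict Implicit.

Variables (F : numClosedFieldType) (T : F -> sl 2 F -> sl 2 F).
Implicit Types (x y z v w : sl 2 F) (a b c : F).

Hypothesis Tlin : forall a, linear (T a).
Hypothesis Tpoly : forall x, polyvec (T^~ x).
Hypothesis Tavg :
  forall a b x y, T (a + b) (lie (T a x) y) = lie (T a x) (T b y).

Let TD a x y : T a (x + y) = T a x + T a y.
Proof. by have := Tlin a 1 x y; rewrite !scale1r. Qed.

Let T0 a : T a 0 = 0.
Proof. by have := Tlin a (-1) 0 0; rewrite !scaleN1r !addNr. Qed.

Let TZ a k x : T a (k *: x) = k *: T a x.
Proof. by have := Tlin a k x 0; rewrite !addr0 T0 addr0. Qed.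

Let TN a x : T a (- x) = - T a x.
Proof. by rewrite -scaleN1r TZ scaleN1r. Qed.

(** This is [2 * det (T a)], since the triple product of [e], [f], [h] is 2; the form keeps it
    visibly polynomial in [a]. *)
Definition vol a := trform (lie (T a sl2_e) (T a sl2_f)) (T a sl2_h).

Lemma vol_inj c x : vol c != 0 -> T c x = 0 -> x = 0.
Proof.
move=> d0; rewrite {1}(sl2_decomp x) !TD !TZ => /(trform_lie_free d0)[*].
by apply: sl2P; rewrite sl2E.
Qed.

Lemma vol_neq0_scalar c : vol c != 0 -> exists k, forall a x, T a x = k *: x.
Proof.
move=> c0; have volP : polyfun vol.
  by apply: polyfun_trform => //; apply: polyvec_lie.
have sym0 a x y : lie (T a x) y = lie x (T 0 y).
  apply/subr0_eq; set u := fun a => lie (T a x) y - lie x (T 0 y).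
  have uP : polyvec u.
    move=> i j; apply: (@eq_polyfun _ _
      (fun a => lie (T a x) y i j - lie x (T 0 y) i j)).
      by move=> b; rewrite /u sl2DE sl2NE.
    apply: polyfunD; last exact: polyfun_cst.
    by apply: polyvec_lie => //; exact: polyvec_cst.
  (* [T b] sends both brackets in [u b] to [lie (T b x) (T 0 y)]: use the averaging identity at
     [(b, 0)] for the first and at [(0, b)], with arguments swapped, for the second. *)
  have u0 b : vol b != 0 -> u b = 0.
    move=> b0; apply: (vol_inj b0); rewrite /u TD TN.
    have := Tavg b 0 x y; rewrite addr0 => ->.
    have := Tavg 0 b y x; rewrite add0r (lieC _ x) TN (lieC _ (T b x)).
    move=> /oppr_inj->.
    exact: subrr.
  have uz i j b : u b i j = 0.
    by move: b; apply: (polyfun_dense (uP i j) volP c0) => b /u0->; rewrite sl2E.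
  by change (u a = 0); apply: sl2P; rewrite uz sl2E.
have cst a x : T a x = T 0 x.
  apply/subr0_eq/lie_center => y.
  by rewrite lieDl -scaleN1r lieZl !sym0 scaleN1r subrr.
(* By [sym0] and antisymmetry every [z] commutes with [T 0 z], hence is an eigenvector if nonzero;
   [sym0] then equates the eigenvalues of two noncommuting vectors. *)
have eig x y : lie x y != 0 -> exists2 k, T 0 x = k *: x & T 0 y = k *: y.
  have ev z : lie z (T 0 z) = 0.
    have := sym0 0 z z; rewrite lieC => /esym/eqP.
    by rewrite -addr_eq0 -mulr2n -scaler_nat scaler_eq0 pnatr_eq0 => /eqP.
  move=> xy0; have x0 : x != 0 by apply: contraNneq xy0 => ->; rewrite lie0x.
  have y0 : y != 0 by apply: contraNneq xy0 => ->; rewrite liex0.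
  have [k xk] := lie_eq0 x0 (ev x); have [l yl] := lie_eq0 y0 (ev y).
  exists k => //; have := sym0 0 x y; rewrite xk yl lieZl lieZr => /eqP.
  by rewrite -subr_eq0 -scalerBl scaler_eq0 (negPf xy0) orbF subr_eq0 => /eqP->.
have h0 := sl2_h_neq0 F; have e0 := sl2_e_neq0 F.
have [|k ek fk] := eig sl2_e sl2_f; first by rewrite lie_ef.
have [|l hl el] := eig sl2_h sl2_e.
  by rewrite lie_he scaler_eq0 pnatr_eq0 (negPf e0).
have lk : l = k.
  apply/eqP; rewrite -subr_eq0; apply: contraNT e0 => lk.
  have : (l - k) *: (sl2_e : sl 2 F) == 0 by rewrite scalerBl -el ek subrr.
  by rewrite scaler_eq0 (negPf lk).
exists k => a x; rewrite cst (sl2_decomp x) !TD !TZ ek fk hl lk.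
by rewrite !scalerDr !scalerA !(mulrC k).
Qed.

(** * Degenerate families: all values commute *)

Section VolumeZero.

Hypothesis vol0 : forall a, vol a = 0.

Lemma vol0_trform a x y z : trform (lie (T a x) (T a y)) (T a z) = 0.
Proof.
rewrite (sl2_decomp x) (sl2_decomp y) (sl2_decomp z) !TD !TZ.
by rewrite trform_lie_comb -/(vol a) vol0 mulr0.
Qed.

Lemma normal_orthogonal x y b c :
  trform (lie (T b x) (T b y)) (lie (T c x) (T c y)) = 0.
Proof.
set n := fun a => lie (T a x) (T a y); rewrite -/(n b) -/(n c).
have nP : polyvec n by exact: polyvec_lie.
have [->|nb0] := eqVneq (n b) 0; first exact: trform0x.
have -> : c = (c - b) + b by rewrite subrK.
apply: (polyvec_dense (f := fun a => trform (n b) (n (a + b))) _ nP nb0)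
  => [|a na0].
  by apply: polyfun_trform; [exact: polyvec_cst | exact: polyvec_shift].
(* By averaging, [lie (T a z) (T b w)] lies in the image of [T (a + b)], to which [n (a + b)] is
   orthogonal. *)
have nT z w : trform (lie (n (a + b)) (T a z)) (T b w) = 0.
  by rewrite -trform_lie -Tavg vol0_trform.
(* Expand [lie (n b) (lie (n (a + b)) (T a z))] in two ways; since [n b] is itself a bracket of
   values of [T b], [nT] makes it vanish. *)
have nb z : trform (n b) (n (a + b)) *: T a z = trform (n b) (T a z) *: n (a + b).
  apply/subr0_eq/eqP; have := lie_lie (n b) (n (a + b)) (T a z).
  rewrite lieC lie_lie !nT !scale0r subrr scaler0 oppr0 => /esym/eqP.
  by rewrite scaler_eq0 pnatr_eq0.
(* A nonzero pairing would put the image of [T a] on the line of [n (a + b)], so that [n a = 0]. *)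
apply/eqP; apply: contraNT na0 => t0.
rewrite -(inj_eq (scalerI (mulf_neq0 t0 t0))) scaler0 -scalerA -lieZr -lieZl !nb.
by rewrite lieZl lieZr liexx !scaler0.
Qed.

Lemma lie_image0 a x y : lie (T a x) (T a y) = 0.
Proof.
apply/eqP; apply: contraT => na0; set n0 := lie _ _ in na0.
have nP : polyvec (fun a => lie (T a x) (T a y)) by exact: polyvec_lie.
have n0T c z : trform n0 (T c z) = 0.
  move: c; apply: (polyvec_dense _ nP na0) => [|c nc0].
    by apply: polyfun_trform => //; exact: polyvec_cst.
  have [t ->] : exists t, n0 = t *: lie (T c x) (T c y).
    by apply: lie_eq0 => //; apply: lie_isotropic; exact: normal_orthogonal.
  by rewrite trformZl vol0_trform mulr0.
(* Write [w] as a sum of brackets with [T a x] and [T a y]; averaging with second parameter [c - a]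
   turns [T c w] into brackets of vectors orthogonal to [n0]. *)
have n0L c w : lie n0 (T c w) = 0.
  have [y1 [y2 ->]] := lie_span w na0.
  have -> : c = a + (c - a) by rewrite addrC subrK.
  by rewrite TD !Tavg lieDr !lie_lie !n0T !scale0r !subrr !scaler0 addr0.
by have := na0; rewrite {1}/n0 (lie_eq0_trans na0) ?eqxx.
Qed.

(** If [lie (T d x) (T b' y)] is nonzero, it lies in the image of [T (d + b')] and so spans it;
    being a bracket with [T d x], it is orthogonal to [T d x]. Density in [d] and in [b'] removes
    the genericity. *)
Lemma image_orthogonal a x b y : lie (T a x) (T b y) != 0 ->
  forall c d w, trform (T c w) (T d x) = 0.
Proof.
move=> ab0 c d w; have -> : c = (c - d) + d by rewrite subrK.
have LP b' : polyvec (fun a => lie (T a x) (T b' y)).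
  by apply: polyvec_lie => //; exact: polyvec_cst.
have RP : polyvec (fun b => lie (T a x) (T b y)).
  by apply: polyvec_lie => //; exact: polyvec_cst.
move: (c - d); apply: (polyvec_dense _ RP ab0) => [|b' ab'].
  by apply: polyfun_trform; [exact: (polyvec_shift d (Tpoly w))
    | exact: polyvec_cst].
rewrite addrC; move: d; apply: (polyvec_dense _ (LP b') ab') => [|d db'].
  by apply: polyfun_trform => //; exact: (polyvec_shift b' (Tpoly w)).
have [|t ->] := lie_eq0 db' (x := T (d + b') w); first by rewrite -Tavg lie_image0.
by rewrite trformZl trformC trform_lie liexx trform0x mulr0.
Qed.

Lemma lie_images0 a x b y : lie (T a x) (T b y) = 0.
Proof.
apply/eqP; apply: contraT => ab0; have A := image_orthogonal ab0.
have B : forall c d w, trform (T c w) (T d y) = 0.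
  apply: (@image_orthogonal b y a x); by rewrite lieC oppr_eq0.
by have := ab0; rewrite lie_isotropic ?eqxx.
Qed.

End VolumeZero.

Lemma averaging_family :
  (exists k, forall a x, T a x = k *: x) \/
  exists v, [/\ v != 0, exists a x, T a x != 0,
    forall a x, lie v (T a x) = 0 & forall a y, T a (lie v y) = 0].
Proof.
have [[c c0]|/forallNP vol0] := pselect (exists c, vol c != 0).
  by left; exact: vol_neq0_scalar c0.
have {}vol0 a : vol a = 0 by apply/eqP/negPn/negP; exact: vol0.
have [[a [x ax0]]|T_0] := pselect (exists a x, T a x != 0); last first.
  left; exists 0 => a x; rewrite scale0r; apply/eqP/negPn/negP => ax0.
  by apply: T_0; exists a, x.
(* Any nonzero value serves as [v]; the last property is averaging at [(a, b - a)]. *)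
right; exists (T a x); split=> // [|b y|b y]; first by exists a, x.
  exact: lie_images0.
by have -> : b = a + (b - a); [rewrite addrC subrK | rewrite Tavg lie_images0].
Qed.

End Family.

(** * Passing from formal variables to scalars *)

Section Evaluation.

Set Implicit Arguments.
Unset Strict Implicit.

Lemma slmapZ n (K L : comNzRingType) (f : {rmorphism K -> L}) a (x : sl n K) :
  slmap f (a *: x) = f a *: slmap f x.
Proof. by apply/val_inj; rewrite /= map_mxZ. Qed.

Lemma slmap_lie n (K L : comNzRingType) (f : {rmorphism K -> L}) (x y : sl n K) :
  slmap f (lie x y) = lie (slmap f x) (slmap f y).
Proof. by apply/val_inj; rewrite /= map_mxB !map_mxM. Qed.

Lemma slmap_sum n (K L : comNzRingType) (f : {rmorphism K -> L}) (I : Type)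
    (r : seq I) (P : pred I) (E : I -> sl n K) :
  slmap f (\sum_(i <- r | P i) E i) = \sum_(i <- r | P i) slmap f (E i).
Proof.
by apply: big_morph => [x y|]; apply/val_inj; rewrite /= ?map_mxD ?map_mx0.
Qed.

Variables (n : nat) (K : comNzRingType).

Definition sleval (a : K) : sl n {poly K} -> sl n K := slmap (horner_eval a).

Lemma slevalE a z i j : sleval a z i j = (z i j).[a].
Proof. by rewrite /= mxE. Qed.

Lemma sleval_sum a (z : sl n {poly K}) :
  sleval a z = \sum_(k < slsize z) a ^+ k *: slcoef k z.
Proof.
apply/val_inj/matrixP => i j; rewrite slevalE.
(* [slsize z] bounds the size of every entry, so one range of summation serves all entries. *)
rewrite (@horner_coef_wide _ (slsize z)); last first.
  by apply: leq_trans (leq_bigmax j) (leq_bigmax i).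
rewrite (big_morph (fun x : sl n K => x i j) (id1 := 0) (op1 := +%R)) => [|x y|].
- by apply: eq_bigr => k _; rewrite /= !mxE mulrC.
- by rewrite /= mxE.
- by rewrite /= mxE.
Qed.

Lemma slmap_slext (L : comNzRingType) (f : {rmorphism L -> K}) (b : L)
    (S : sl n K -> sl n L) (c : K)
    (S' : sl n K -> sl n K) (z : sl n {poly K}) :
  f b = c -> linear S' -> (forall x, slmap f (S x) = S' x) ->
  slmap f (slext b S z) = S' (sleval c z).
Proof.
move=> <- S'lin SS'; have S'D x y : S' (x + y) = S' x + S' y.
  by have := S'lin 1 x y; rewrite !scale1r.
have S'0 : S' 0 = 0.
  by have := S'lin (-1) 0 0; rewrite !scaleN1r !addNr.
have S'Z k x : S' (k *: x) = k *: S' x.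
  by have := S'lin k x 0; rewrite !addr0 S'0 addr0.
rewrite /slext slmap_sum sleval_sum (big_morph _ S'D S'0).
by apply: eq_bigr => k _; rewrite slmapZ rmorphXn SS' S'Z.
Qed.

(** The outer variable mu goes first, to the constant polynomial [b]; then the inner variable lambda
    goes to [a]. *)
Definition ev2 (a b : K) : {poly {poly K}} -> K :=
  horner_eval a \o horner_eval b%:P.
HB.instance Definition _ a b := GRing.RMorphism.on (ev2 a b).

Lemma slmap_ev2_lambda a b (z : sl n {poly K}) :
  slmap (ev2 a b) (at_lambda z) = sleval a z.
Proof.
by apply/val_inj/matrixP => i j; rewrite /= !mxE /ev2 /= /horner_eval hornerC.
Qed.

Lemma slmap_ev2_mu a b (z : sl n {poly K}) :
  slmap (ev2 a b) (at_mu z) = sleval b z.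
Proof.
apply/val_inj/matrixP => i j; rewrite /= !mxE /ev2 /= /horner_eval.
by rewrite horner_map hornerC.
Qed.

Lemma slmap_ev2_lambda_plus_mu a b (z : sl n {poly K}) :
  slmap (ev2 a b) (at_lambda_plus_mu z) = sleval (a + b) z.
Proof.
apply/val_inj/matrixP => i j; rewrite /= !mxE /ev2 /= /horner_eval.
by rewrite horner_poly_XaY horner_comp !hornerE addrC.
Qed.

Lemma sleval_const a (x : sl n K) : sleval a (slconst x) = x.
Proof. by apply/val_inj/matrixP => i j; rewrite /= !mxE /horner_eval hornerC. Qed.

Lemma sleval_lie a (x y : sl n {poly K}) :
  sleval a (lie x y) = lie (sleval a x) (sleval a y).
Proof. exact: slmap_lie. Qed.

Lemma sleval_linear (T : sl_conformal_map n K) a :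
  linear (fun x => sleval a (T x)).
Proof.
move=> k x y; rewrite linearP; apply/val_inj/matrixP => i j.
by rewrite /= !mxE /horner_eval !hornerE.
Qed.

Lemma averaging_eval (T : sl_conformal_map n K) a b x y :
  conformal_averaging T ->
  sleval (a + b) (T (lie (sleval a (T x)) y)) =
  lie (sleval a (T x)) (sleval b (T y)).
Proof.
move=> /(_ x y)/(congr1 (slmap (ev2 a b))).
rewrite slmap_lie slmap_ev2_lambda slmap_ev2_mu.
rewrite (slmap_slext (c := a) _ _ (sleval_linear T (a + b))) => [|//|z].
- by rewrite sleval_lie sleval_const.
- by change ('X%:P.[b%:P].[a] = a); rewrite hornerC hornerX.
- exact: slmap_ev2_lambda_plus_mu.
Qed.

Lemma sleval_slconj a (s s' : sl n K -> sl n K) T x : linear s ->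
  sleval a (slconj s s' T x) = s (sleval a (T (s' x))).
Proof.
move=> slin; apply: slmap_slext => // [|z]; last exact: sleval_const.
exact: hornerX.
Qed.

End Evaluation.

(** * Inner automorphisms given by invertible matrices *)

Section Conjugation.

Set Implicit Arguments.
Unset Strict Implicit.

Variables (n : nat) (K : comUnitRingType) (P : 'M[K]_n).
Hypothesis Punit : P \in unitmx.

Fact slconjug_subproof (x : sl n K) : P *m x *m invmx P \in @traceless n K.
Proof. by rewrite unfold_in mxtrace_mulC mulKmx //; case: x. Qed.
Definition slconjug x := Sl (slconjug_subproof x).

Fact slconjugV_subproof (x : sl n K) : invmx P *m x *m P \in @traceless n K.
Proof. by rewrite unfold_in mxtrace_mulC mulKVmx //; case: x. Qed.
Definition slconjugV x := Sl (slconjugV_subproof x).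

Lemma slconjugK : cancel slconjug slconjugV.
Proof. by move=> x; apply/val_inj; rewrite /= !mulmxA mulVmx // mul1mx mulmxKV. Qed.

Lemma slconjugVK : cancel slconjugV slconjug.
Proof. by move=> x; apply/val_inj; rewrite /= !mulmxA mulmxV // mul1mx mulmxK. Qed.

Lemma slconjug_eq (v w : sl n K) : P *m v = w *m P -> slconjug v = w.
Proof. by move=> Pv; apply/val_inj; rewrite /= Pv mulmxK. Qed.

Lemma slconjug_is_linear : linear slconjug.
Proof.
by move=> k x y; apply/val_inj; rewrite /= mulmxDr mulmxDl -scalemxAr -scalemxAl.
Qed.

Lemma slconjugV_is_linear : linear slconjugV.
Proof.
by move=> k x y; apply/val_inj; rewrite /= mulmxDr mulmxDl -scalemxAr -scalemxAl.
Qed.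

HB.instance Definition _ :=
  GRing.isLinear.Build K (sl n K) (sl n K) _ slconjug slconjug_is_linear.
HB.instance Definition _ :=
  GRing.isLinear.Build K (sl n K) (sl n K) _ slconjugV slconjugV_is_linear.

Lemma slconjug_automorphism : lie_automorphism slconjug.
Proof.
split; first exact: slconjug_is_linear; last first.
  by exists slconjugV; [exact: slconjugK | exact: slconjugVK].
move=> x y; apply/val_inj; rewrite /= mulmxBr mulmxBl.
by rewrite !mulmxA !(mulmxKV Punit).
Qed.

End Conjugation.

(** * Conjugating a nonzero element to [e] or to a multiple of [h] *)

Section NormalForm.

Set Implicit Arguments.
Unset Strict Implicit.

Variable F : numClosedFieldType.
Implicit Types v : sl 2 F.

Definition mx22 (a b c d : F) : 'M_2 :=
  \matrix_(i, j) if i == 0 then (if j == 0 then a else b)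
                 else (if j == 0 then c else d).

Lemma mx22_unit a b c d : a * d - b * c != 0 -> mx22 a b c d \in unitmx.
Proof.
rewrite unitmxE unitfE (expand_det_row _ 0) !big_ord_recl big_ord0 /cofactor.
by rewrite !det_mx11 !mxE /= expr0 expr1 mul1r mulN1r addr0 mulrN.
Qed.

Lemma mx22P (A B : 'M[F]_2) : A 0 0 = B 0 0 -> A 0 1 = B 0 1 ->
  A 1 0 = B 1 0 -> A 1 1 = B 1 1 -> A = B.
Proof.
move=> e00 e01 e10 e11; apply/matrixP => i j.
by have [->|->] := ord2 i; have [->|->] := ord2 j.
Qed.

(** The expression is the determinant of the rows [(x, y)] and [(x, y) v]. A nonzero traceless
    matrix is not scalar in characteristic 0, so some row is cyclic. *)
Lemma cyclic_covector v : v != 0 -> exists x y : F,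
  x * (x * v 0 1 - y * v 0 0) - y * (x * v 0 0 + y * v 1 0) != 0.
Proof.
move=> v0; have [/eqP e|e0] := boolP (v 0 1 == 0); last first.
  by exists 1, 0; rewrite !mul1r !mul0r !subr0.
have [/eqP f|f0] := boolP (v 1 0 == 0); last first.
  by exists 0, 1; rewrite !mul1r !mul0r !add0r oppr_eq0.
exists 1, 1; rewrite e f !mul1r addr0 sub0r -opprD oppr_eq0 -mulr2n mulrn_eq0 /=.
by apply: contraNneq v0 => h; apply/eqP/sl2P; rewrite sl2E.
Qed.

Lemma sl2_normal_form v : v != 0 -> exists2 P : 'M[F]_2, P \in unitmx &
  P *m v = (sl2_e : sl 2 F) *m P \/
  exists2 k, k != 0 & P *m v = (k *: sl2_h : sl 2 F) *m P.
Proof.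
move=> v0; have [x [y d0]] := cyclic_covector v0.
set p := v 0 0 in d0 *; set q := v 0 1 in d0 *; set r := v 1 0 in d0 *.
(* By Cayley-Hamilton [v] squares to the scalar [p ^+ 2 + q * r], so its eigenvalues are [k] and
   [- k]. *)
pose k := sqrtC (p ^+ 2 + q * r).
have kE : k ^+ 2 = p ^+ 2 + q * r by rewrite sqrtCK.
set a := x * p + y * r in d0; set b := x * q - y * p in d0.
have [k0|k0] := eqVneq k 0.
  (* Nilpotent case: the rows of [P] are the cyclic row and its image under [v]. *)
  have qr : q * r = - p ^+ 2.
    by apply/eqP; rewrite -addr_eq0 addrC -kE k0 expr0n.
  exists (mx22 x y a b); first by apply: mx22_unit.
  left; apply: mx22P; rewrite !mulmx22E ?sl2_trace !mxE /= -/p -/q -/r /a /b; ring: qr.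
have kE' : q * r = k ^+ 2 - p ^+ 2 by rewrite kE addrC addKr.
(* With [u] the cyclic row, [u v + k u] and [u v - k u] are left eigenvectors for [k] and [- k]. *)
exists (mx22 (a + k * x) (b + k * y) (a - k * x) (b - k * y)).
  apply: mx22_unit; rewrite (_ : _ - _ = 2%:R * k * (x * b - y * a)); last by ring.
  by rewrite !mulf_neq0 // pnatr_eq0.
right; exists k => //.
by apply: mx22P; rewrite !mulmx22E ?sl2_trace !mxE /= -/p -/q -/r /a /b; ring: kE'.
Qed.

End NormalForm.

(** * Assembling the classification *)

Section Classification.

Set Implicit Arguments.
Unset Strict Implicit.

Variable F : numClosedFieldType.

Lemma sleval_inj n (z z' : sl n {poly F}) :
  (forall a, sleval a z = sleval a z') -> z = z'.
Proof.
move=> zz'; apply/val_inj/matrixP => i j; apply: poly_eq_horner => a.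
by rewrite -!slevalE zz'.
Qed.

Lemma averaging_classification (T : sl_conformal_map 2 F) :
  conformal_averaging T ->
  exists s s' : sl 2 F -> sl 2 F,
    [/\ lie_automorphism s, cancel s s', cancel s' s &
      let T' := slconj s s' T in
      [\/ exists alpha : F, forall x, T' x = slconst (alpha *: x),
          exists2 phi : {poly F}, phi != 0 &
            [/\ T' sl2_e = 0, T' sl2_f = 0 & T' sl2_h = phi *: slconst sl2_h] |
          exists2 phi : {poly F}, phi != 0 &
            [/\ T' sl2_e = 0, T' sl2_h = 0 & T' sl2_f = phi *: slconst sl2_e]]].
Proof.
move=> hT; pose Te a x := sleval a (T x).
have Tpoly x : polyvec (Te^~ x).
  by move=> i j; exists (T x i j) => a; rewrite -slevalE.
have Tavg a b x y : Te (a + b) (lie (Te a x) y) = lie (Te a x) (Te b y).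
  exact: averaging_eval.
have eval_eq0 (z : sl 2 {poly F}) : (forall a, sleval a z = 0) -> z = 0.
  move=> z0; apply: sleval_inj => a; rewrite z0.
  by apply: sl2P; rewrite slevalE !sl2_0E horner0.
have sleval_phi a (phi : {poly F}) x : sleval a (phi *: slconst x) = phi.[a] *: x.
  by rewrite [LHS]slmapZ [slmap _ _]sleval_const.
case: (averaging_family (sleval_linear T) Tpoly Tavg) => [[k Tk]|].
  exists id, id; split=> //; first by split=> //; exists id.
  constructor 1; exists k => x; apply: sleval_inj => a.
  by rewrite sleval_slconj // sleval_const; exact: Tk.
move=> [v [v0 [a0 [x0 Tx0]] vT Tv]].
have [P Punit Pv] := sl2_normal_form v0.
have sK := slconjugK Punit; have sVK := slconjugVK Punit.
have [slin slie sbij] := slconjug_automorphism Punit.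
exists (slconjug Punit), (slconjugV Punit); split=> // T'.
have T'E a x : sleval a (T' x) = slconjug Punit (Te a (slconjugV Punit x)).
  by rewrite sleval_slconj.
(* The conjugated map kills all brackets with the conjugate [w] of [v]; this yields its zeros on the
   basis. *)
have T'w w k y x : slconjug Punit v = w -> k != 0 -> lie w y = k *: x -> T' x = 0.
  move=> vw k0 wy; apply: eval_eq0 => a; rewrite T'E.
  have -> : x = slconjug Punit (lie v (k^-1 *: slconjugV Punit y)).
    by rewrite slie vw linearZ /= sVK lieZr wy scalerA mulVf ?scale1r.
  by rewrite sK [Te _ _]Tv linear0.
have T'neq0 : ~ [/\ T' sl2_e = 0, T' sl2_f = 0 & T' sl2_h = 0].
  move=> [T'e T'f T'h]; move/eqP: Tx0; apply; apply: (can_inj sK).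
  rewrite linear0.
  rewrite -(sK x0) (sl2_decomp (slconjug Punit x0)).
  pose G x := slconjug Punit (Te a0 (slconjugV Punit x)).
  have GP : linear G.
    by move=> k x y; rewrite /G linearP [Te _ _](sleval_linear T) linearP.
  have G0 : G 0 = 0 by have := GP (-1) 0 0; rewrite !scaleN1r !addNr.
  (* The padding by 0 brings every summand to the shape [k *: x + y] required by [GP]. *)
  rewrite -[_ *: sl2_h]addr0 -!addrA -/(G _) !GP G0 /G -!T'E T'e T'f T'h.
  have -> : sleval a0 (0 : sl 2 {poly F}) = 0.
    by apply: sl2P; rewrite slevalE !sl2_0E horner0.
  by rewrite !scaler0 !addr0.
(* All values commute with the conjugate of [v], hence are multiples of [u]; as [u i j = 1], the
   polynomial factor is the [(i, j)] entry. *)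
have T'u (u : sl 2 F) i j y :
    u != 0 -> u i j = 1 -> (exists k, slconjug Punit v = k *: u) ->
    T' y = T' y i j *: slconst u.
  move=> u0 uij [k vu]; apply: sleval_inj => a; rewrite sleval_phi -slevalE.
  have : lie (k *: u) (sleval a (T' y)) = 0 by rewrite T'E -vu -slie vT linear0.
  have k0 : k != 0.
    by apply: contraNneq v0 => k0; rewrite -(can_eq sK) vu k0 scale0r linear0.
  rewrite lieZl => /eqP; rewrite scaler_eq0 (negPf k0) => /eqP/(lie_eq0 u0)[t ->].
  by rewrite sl2ZE uij mulr1.
have e1 : (sl2_e : sl 2 F) 0 1 = 1 by rewrite /= mxE.
have h1 : (sl2_h : sl 2 F) 0 0 = 1 by rewrite /= !mxE subr0.
have e0 := sl2_e_neq0 F; have h0 := sl2_h_neq0 F.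
case: Pv => [/(slconjug_eq Punit) vw|[k k0 /(slconjug_eq Punit) vw]].
  have T'h : T' sl2_h = 0.
    by apply: (T'w _ 1 sl2_f _ vw); rewrite ?oner_neq0 // lie_ef scale1r.
  have T'e : T' sl2_e = 0.
    apply: (T'w _ (- 2%:R) sl2_h _ vw); first by rewrite oppr_eq0 pnatr_eq0.
    by rewrite lieC lie_he scaleNr.
  have T'f : T' sl2_f = T' sl2_f 0 1 *: slconst sl2_e.
    by apply: T'u => //; exists 1; rewrite scale1r.
  constructor 3; exists (T' sl2_f 0 1) => //.
  by apply/eqP => phi0; apply: T'neq0; split=> //; rewrite T'f phi0 scale0r.
have T'e : T' sl2_e = 0.
  apply: (T'w _ (k * 2%:R) sl2_e _ vw); first by rewrite mulf_neq0 // pnatr_eq0.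
  by rewrite lieZl lie_he scalerA.
have T'f : T' sl2_f = 0.
  apply: (T'w _ (k * - 2%:R) sl2_f _ vw).
    by rewrite mulf_neq0 // oppr_eq0 pnatr_eq0.
  by rewrite lieZl lie_hf scalerA.
have T'h : T' sl2_h = T' sl2_h 0 0 *: slconst sl2_h.
  by apply: T'u => //; exists k.
constructor 2; exists (T' sl2_h 0 0) => //.
by apply/eqP => phi0; apply: T'neq0; split=> //; rewrite T'h phi0 scale0r.
Qed.

End Classification.

Theorem proposition3 (R : realType) (T : sl_conformal_map 2 R[i])
    (hT : conformal_averaging T) :
  exists s s' : sl 2 R[i] -> sl 2 R[i],
    [/\ lie_automorphism s, cancel s s', cancel s' s &
      let T' := slconj s s' T in
      [\/ exists alpha : R[i], forall x, T' x = slconst (alpha *: x),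
          exists2 phi : {poly R[i]}, phi != 0 &
            [/\ T' sl2_e = 0, T' sl2_f = 0 & T' sl2_h = phi *: slconst sl2_h] |
          exists2 phi : {poly R[i]}, phi != 0 &
            [/\ T' sl2_e = 0, T' sl2_h = 0 & T' sl2_f = phi *: slconst sl2_e]]].
Proof. exact: averaging_classification hT. Qed.
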